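(* Let $n$ be a positive integer and let $\mathbb{D}_{2n}=\langle a,b\mid a^n=b^2=1,\ b^{-1}ab=a^{-1}\rangle$ be the dihedral group of order $2n$. Let $X$ be a normal subset of $\mathbb{D}_{2n}$ such that the Cayley sum graph $\mathrm{CS}(\mathbb{D}_{2n},X)$ is connected and has a subgroup perfect code $H\neq\{1\}$. Then one of the following holds: (a) $n=2\ell$ is even and $X=b^{\mathbb{D}_{2n}}\cup\{a^2,a^4,\dots,a^{2\ell-2}\}$; (b) $n=2\ell$ is even and $X=(ab)^{\mathbb{D}_{2n}}\cup\{a^2,a^4,\dots,a^{2\ell-2}\}$; (c) $n=4k+2$ for a positive integer $k$, and there is an inverse-closed left transversal $Z$ of $\langle a^{2k+1}\rangle$ in $\langle a\rangle$ such that $X=b^{\mathbb{D}_{2n}}\cup(Z\setminus\langle a^{2k+1}\rangle)$ or $X=(ab)^{\mathbb{D}_{2n}}\cup(Z\setminus\langle a^{2k+1}\rangle)$.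
   Context: A subset $X$ of a finite group $G$ is normal if $g^{-1}Xg=X$ for all $g\in G$. The Cayley sum graph $\mathrm{CS}(G,X)$ has vertex set $G$, with distinct vertices $g,h$ adjacent iff $gh\in X$. A perfect code in a graph is an independent set $C$ of vertices such that every vertex outside $C$ has exactly one neighbour in $C$; a subgroup perfect code is a subgroup that is a perfect code. $g^{G}$ denotes the conjugacy class of $g$; when $n=2\ell$ is even, $b^{\mathbb{D}_{2n}}=\{b,a^2b,\dots,a^{2\ell-2}b\}$ and $(ab)^{\mathbb{D}_{2n}}=\{ab,a^3b,\dots,a^{2\ell-1}b\}$.
   Formalization: In each case the conclusion is stated for X∖{1} instead of X, since the printed claim fails when 1∈X (e.g. n=6, X={1,a,a^5,b,a^2b,a^4b}, H={1,a^3}); when 1∉X it is exactly the printed claim. *)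

(* Defs.v *)
From mathcomp Require Import all_boot all_fingroup all_solvable.

Set Implicit Arguments.
Unset Strict Implicit.
Unset Printing Implicit Defensive.

Local Open Scope group_scope.

(* The whole of gT is the dihedral group of order 2n, and a, b are the
   generators of its presentation.  The extremal.v type 'D_(n.*2) is not used
   because it is this group only for n > 1; here n = 1 (order 2) is allowed. *)
Definition is_dihedral (n : nat) (gT : finGroupType) (a b : gT) : Prop :=
  [/\ [set: gT] \isog Grp (x : y : x ^+ n, y ^+ 2, x ^ y = x^-1),
      <<[set a; b]>> = [set: gT],
      a ^+ n = 1,
      b ^+ 2 = 1 &
      a ^ b = a^-1].

(* X may contain 1, which only adds the edges {g, g^-1} with g <> g^-1.  No edge
   between a subgroup and its complement has product 1, so a perfect code
   {1, h} with h an involution does not determine whether 1 \in X: connection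
   sets can be recovered from it only up to 1, i.e. in the form X :\ 1, which
   is X itself when 1 \notin X. *)
Definition cayley_sum (gT : finGroupType) (X : {set gT}) : rel gT :=
  fun g h => (g != h) && (g * h \in X).

(* Needed for `connect` below to be undirected connectivity. *)
Lemma cayley_sum_sym (gT : finGroupType) (X : {set gT}) :
  X <| [set: gT] -> symmetric (cayley_sum X).
Proof.
case/andP=> _ nX g h; rewrite /cayley_sum eq_sym; congr (_ && _).
have ->: h * g = (g * h) ^ g by rewrite conjgE mulgA mulKg.
by rewrite memJ_norm // (subsetP nX) ?inE.
Qed.

Definition graph_connected (T : finType) (e : rel T) : Prop :=
  forall x y : T, connect e x y.

Definition perfect_code (T : finType) (e : rel T) (C : {set T}) : Prop :=
  {in C &, forall x y, ~~ e x y}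
  /\ (forall v, v \notin C -> #|[set c in C | e v c]| = 1%N).

Definition left_transversal (gT : finGroupType) (Z K A : {set gT}) : Prop :=
  is_transversal Z (lcosets K A) A.

Definition inverse_closed (gT : finGroupType) (Z : {set gT}) : Prop :=
  Z^-1 = Z.

(* {a^2, a^4, ..., a^(2l-2)}; empty for l = 1. *)
Definition even_powers (gT : finGroupType) (a : gT) (l : nat) : {set gT} :=
  [set a ^+ (2 * i) | i : 'I_l & (0 < i)%N].

(* Main.v *)
(* Put Y = X :\ 1.  As H is a perfect code, H misses Y and every coset v H other
   than H meets Y in exactly one element.  Connectedness puts a reflection in Y,
   hence a full class of reflections.  If Y contained all reflections, it would
   meet H or contain two elements of one coset of H; thus n is even and Y
   contains exactly one of the two classes.  Translating a reflection of Y by an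
   even power of a in H stays in Y, so 1 is the only such power.  Hence H is
   either {1, r} with r a reflection outside Y, which forces the rotations in Y
   to be the nontrivial even powers of a, or {1, a^(n/2)} with n/2 odd, and then
   Y contains one rotation from each nontrivial coset of H in <a>. *)

Require Import Defs.
From mathcomp Require Import all_boot all_fingroup all_solvable.
From mathcomp Require Import zify.

Local Open Scope group_scope.

Set Implicit Arguments.
Unset Strict Implicit.

(* The type 'D_2 of extremal.v does not have order 2, so the case n = 1 maps the
   presentation onto the group generated by a transposition instead. *)
Lemma is_dihedral_card_ge (n : nat) (gT : finGroupType) (a b : gT) :
  (0 < n)%N -> is_dihedral n a b -> (n.*2 <= #|[set: gT]|)%N.
Proof.
case: n => [|[|n]] // _ [isoD _ _ _ _]; last first.
  (* For n at least 2 the standard dihedral group satisfies the relations, so it is a homomorphic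
     image of the presented group. *)
  rewrite -(@card_dihedral n.+2) // leq_homg // isoD.
  by apply: isoGrp_hom; apply: Grp_dihedral.
pose t := tperm true false.
have ot: #[t] = 2%N.
  apply: nt_prime_order => //; first by rewrite expgS expg1 tperm2.
  by apply/eqP=> /permP/(_ true); rewrite tpermL perm1.
rewrite -[1.*2%N]ot orderE leq_homg // isoD.
(* For n = 1 the relations hold with x sent to 1 and y to the transposition. *)
apply/existsP; exists (1, t); rewrite /= !xpair_eqE.
have t2: t ^+ 2 = 1 by rewrite -ot expg_order.
by rewrite cycle1 joing1G expg1n t2 conj1g invg1 !eqxx.
Qed.

(** * Rotations, reflections and conjugacy classes of the dihedral group *)

Section DihedralStructure.

Variables (n : nat) (gT : finGroupType) (a b : gT).
Hypotheses (n_gt0 : (0 < n)%N) (D2n : is_dihedral n a b).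

Lemma dihedral_invJ (x : gT) : x \in <[a]> -> x ^ b = x^-1.
Proof.
by case: D2n => _ _ _ _ ab /cycleP[i ->]; rewrite conjXg ab expgVn.
Qed.

Lemma dihedral_mulbb : b * b = 1.
Proof. by case: D2n => _ _ _ <- _; rewrite expgS expg1. Qed.

Lemma dihedral_invb : b^-1 = b.
Proof. by apply/eqP; rewrite eq_invg_mul dihedral_mulbb. Qed.

Lemma dihedral_refl_swap (x : gT) : x \in <[a]> -> b * x = x^-1 * b.
Proof.
move=> ax; rewrite -(dihedral_invJ ax) conjgE dihedral_invb -!mulgA.
by rewrite dihedral_mulbb mulg1.
Qed.

Lemma dihedral_mul : <[a]> * <[b]> = [set: gT].
Proof.
case: (D2n) => _ <- _ _ ab.
rewrite -norm_joinEr ?joing_idl ?joing_idr //.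
by rewrite cycle_subG inE -cycleJ ab cycleV.
Qed.

(** The relations give orders at most n and 2, so the product of the two cycles has at most 2n
    elements. The presentation forces at least 2n, so every bound is attained and the cycles meet
    trivially. *)
Lemma dihedral_order : #[a] = n /\ b \notin <[a]>.
Proof.
have [isoD _ an b2 _] := D2n.
have leG := is_dihedral_card_ge n_gt0 D2n.
have oa: (#[a] <= n)%N by rewrite dvdn_leq // order_dvdn an.
have ob: (#[b] <= 2)%N by rewrite dvdn_leq // order_dvdn b2.
have := mul_cardG <[a]> <[b]>; rewrite dihedral_mul -!orderE => defG.
have I_gt0 := cardG_gt0 (<[a]> :&: <[b]>).
have lemul: (#[a] * #[b] <= n * 2)%N by rewrite leq_mul.
have o_gt0 := order_gt0 a.
rewrite defG in lemul.
have I1: #|<[a]> :&: <[b]>| = 1%N.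
  move: leG lemul I_gt0 n_gt0; rewrite -muln2.
  move: #|[set: gT]| #|_ :&: _| => g i; nia.
rewrite I1 muln1 in lemul defG.
split.
  move: defG leG oa ob o_gt0; rewrite -muln2.
  by move: #|[set: gT]| => g; nia.
apply/negP=> ab; move: I1; rewrite (setIidPr _) ?cycle_subG // -orderE => ob1.
move: defG leG oa n_gt0; rewrite ob1 -muln2.
by move: #|[set: gT]| => g; nia.
Qed.

Lemma dihedral_cases (g : gT) :
  g \in <[a]> \/ exists i : nat, g = a ^+ i * b.
Proof.
have: g \in <[a]> * <[b]> by rewrite dihedral_mul inE.
case/mulsgP=> x y /cycleP[i ->] /cycleP[j ->] ->.
rewrite -(odd_double_half j) expgD -muln2 mulnC expgM.
rewrite (expgS b 1) expg1 dihedral_mulbb expg1n mulg1.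
case: odd; first by right; exists i.
by left; rewrite mulg1 mem_cycle.
Qed.

Lemma dihedral_conj_refl (i : nat) : (a ^+ i * b) ^ a^-1 = a ^+ i.+2 * b.
Proof.
have ->: a ^+ i.+2 = a * a ^+ i * a by rewrite expgSr expgS.
rewrite conjgE invgK -!mulgA (dihedral_refl_swap (groupVr (cycle_id a))).
by rewrite invgK !mulgA.
Qed.

(** Conjugation by [a^-1] raises the exponent by 2, which fills the coset. Conversely, a rotation x
    multiplies on the left by x^-2, and a further [b] turns exponent j into -j, which has even
    difference from j. *)
Lemma dihedral_class (i : nat) :
  (a ^+ i * b) ^: [set: gT] = <[a ^+ 2]> :* (a ^+ i * b).
Proof.
have memb c : a ^+ (2 * c + i) * b \in (a ^+ i * b) ^: [set: gT].
  elim: c => [|c IHc]; first by rewrite class_refl.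
  have ->: (2 * c.+1 + i = (2 * c + i).+2)%N by rewrite mulnS.
  by rewrite -dihedral_conj_refl memJ_norm // (subsetP (class_norm _ _)) ?inE.
apply/eqP; rewrite eqEsubset; apply/andP; split; last first.
  apply/subsetP=> _ /rcosetP[_ /cycleP[c ->] ->].
  by rewrite mulgA -expgM -expgD memb.
have inC x : x \in <[a]> -> (a ^+ i * b) ^ x \in <[a ^+ 2]> :* (a ^+ i * b).
  move=> ax; have [k def_x] := cycleP _ _ ax.
  rewrite mem_rcoset conjgE -!mulgA (mulgA b) (dihedral_refl_swap ax) invMg.
  rewrite -!mulgA mulKVg.
  have ca : commute (a ^+ i) x^-1.
    by apply: commuteV; rewrite def_x; apply: commuteX2.
  rewrite (mulgA (a ^+ i)) ca -mulgA mulgV mulg1 -invMg groupV def_x.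
  by rewrite -expgD addnn -muln2 mulnC expgM mem_cycle.
apply/subsetP=> _ /imsetP[g _ ->].
have [ag | [k ->]] := dihedral_cases g; first exact: inC.
have /rcosetP[x] := inC _ (mem_cycle a k); rewrite conjgM => ax ->.
have ax' : x \in <[a]> by apply: subsetP ax; rewrite cycle_subG mem_cycle.
have ai : a ^+ i \in <[a]> by apply: mem_cycle.
rewrite conjMg (conjMg (a ^+ i)) (dihedral_invJ ax') (dihedral_invJ ai).
rewrite (conjgE b) mulKg.
rewrite mem_rcoset invMg !mulgA mulgK -mulgA -invMg -expgD.
by rewrite addnn -muln2 mulnC expgM groupM // groupV ?mem_cycle.
Qed.

(** Exponents of [a] matter only modulo n, and n even makes their parity well defined. *)
Lemma dihedral_even_cycle (i : nat) :
  ~~ odd n -> (a ^+ i \in <[a ^+ 2]>) = ~~ odd i.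
Proof.
move=> n_even; have [oa _] := dihedral_order; apply/idP/idP.
  case/cycleP=> k; rewrite -expgM => /eqP; rewrite eq_expg_mod_order oa => /eqP.
  move/(congr1 odd); rewrite !odd_mod ?(negbTE n_even) // => ->.
  by rewrite oddM.
by move=> i_even; rewrite -(even_halfK i_even) -muln2 mulnC expgM mem_cycle.
Qed.

Lemma dihedral_even_cycleM (x y : gT) :
  ~~ odd n -> x \in <[a]> -> y \in <[a]> ->
  (x * y \in <[a ^+ 2]>) = ((x \in <[a ^+ 2]>) == (y \in <[a ^+ 2]>)).
Proof.
move=> n_even /cycleP[i ->] /cycleP[j ->].
by rewrite -expgD !dihedral_even_cycle // oddD; case: odd; case: odd.
Qed.

Lemma mem_even_powers (l : nat) (x : gT) : n = (2 * l)%N ->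
  (x \in even_powers a l) = (x != 1) && (x \in <[a ^+ 2]>).
Proof.
move=> def_n; have [oa _] := dihedral_order.
apply/imsetP/andP=> [[i] | [nt_x]].
  rewrite inE => i_gt0 ->; rewrite expgM mem_cycle; split=> //.
  rewrite -expgM -order_dvdn oa def_n; apply: contraL (ltn_ord i) => /dvdn_leq.
  by rewrite -leqNgt leq_pmul2l //; apply; rewrite muln_gt0.
case/cyclePmin=> i; rewrite orderXdiv ?oa ?def_n ?dvdn_mulr // mulKn //.
move=> ltil def_x.
exists (Ordinal ltil); last by rewrite def_x -expgM.
by rewrite inE lt0n; apply: contraNneq nt_x => /= i0; rewrite def_x i0.
Qed.

End DihedralStructure.

(** The left cosets are the fibres of the map x -> x H on G. *)
Lemma lcosets_partition (gT : finGroupType) (G H : {group gT}) :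
  H \subset G -> partition (lcosets H G) G.
Proof.
move=> sHG; suffices ->: lcosets H G = preim_partition (fun x => x *: H) G.
  exact: preim_partitionP.
apply: eq_in_imset => x Gx; apply/setP=> y.
rewrite inE lcosetE; have [xHy | xH'y] := boolP (y \in x *: H).
  have Gy : y \in G by apply: subsetP xHy; rewrite mul_subG ?sub1set.
  by rewrite (lcoset_eqP xHy) eqxx Gy.
apply/esym/negbTE; rewrite negb_and; apply/orP; right.
by apply: contraNneq xH'y => ->; apply: lcoset_refl.
Qed.

(** * Subgroup perfect codes in the Cayley sum graph of any finite group *)

Section PerfectCode.

Variables (gT : finGroupType) (X : {set gT}) (H : {group gT}).
Hypothesis codeH : perfect_code (cayley_sum X) H.

Lemma subgroup_code_notin (h : gT) : h \in H -> h \notin X :\ 1.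
Proof.
move=> Hh; rewrite !inE; have [//|nt_h /=] := eqVneq h 1.
by have := proj1 codeH 1 h (group1 H) Hh; rewrite /cayley_sum mul1g eq_sym nt_h.
Qed.

(** For v outside H, neither v = h nor v h = 1 can occur, so adjacency to h is just membership of v
    h; c is the unique neighbour of v in H. *)
Lemma subgroup_code_coset (v : gT) : v \notin H ->
  exists2 c, c \in H & {in H, forall h, (v * h \in X :\ 1) = (h == c)}.
Proof.
move=> H'v; have /eqP/cards1P[c def_c] := proj2 codeH v H'v.
have mem_c h : h \in H -> (v * h \in X :\ 1) = (h == c).
  move=> Hh; rewrite -[h == c]in_set1 -def_c !inE Hh /cayley_sum /=.
  have ->: v != h by apply: contraNneq H'v => ->.
  suffices ->: v * h != 1 by [].
  by apply: contraNneq H'v => vh1; rewrite -(groupMr v Hh) vh1.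
exists c => //; have: c \in [set c] by rewrite set11.
by rewrite -def_c inE => /andP[].
Qed.

End PerfectCode.

(** * Reflections in the connection set and the parity of n *)

Section SubgroupPerfectCode.

Variables (n : nat) (gT : finGroupType) (a b : gT) (X : {set gT}).
Hypotheses (n_gt0 : (0 < n)%N) (D2n : is_dihedral n a b).
Hypotheses (nX : X <| [set: gT]) (connX : graph_connected (cayley_sum X)).
Variable H : {group gT}.
Hypotheses (ntH : H :!=: 1) (codeH : perfect_code (cayley_sum X) H).

Local Notation Y := (X :\ 1).
Local Notation A := <[a]>.
Local Notation E := <[a ^+ 2]>.

Lemma connection_setJ (x g : gT) : (x ^ g \in Y) = (x \in Y).
Proof.
rewrite !inE conjg_eq1 memJ_norm //.
by case/andP: nX => _ /subsetP-> //; rewrite inE.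
Qed.

Lemma dihedral_refl_notin (x : gT) : x \in A -> x * b \notin A.
Proof. by move=> Ax; rewrite groupMl // (proj2 (dihedral_order n_gt0 D2n)). Qed.

(** Otherwise every edge has its product in [A], so no edge leaves [A] and 1 is not connected to
    [b]. *)
Lemma connected_has_reflection : exists i : nat, a ^+ i * b \in Y.
Proof.
have [_ A'b] := dihedral_order n_gt0 D2n.
have [/existsP[g /andP[Yg A'g]] | /existsPn noY] :=
  boolP [exists g, (g \in Y) && (g \notin A)].
  have [Ag | [i def_g]] := dihedral_cases D2n g; first by rewrite Ag in A'g.
  by exists i; rewrite -def_g.
have closedA : closed (cayley_sum X) (mem A).
  move=> x y /andP[_ Xxy] /=; suffices Axy : x * y \in A.
    apply/idP/idP=> [Ax | Ay]; first by rewrite -(groupMl y Ax).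
    by rewrite -(groupMr x Ay).
  have := noY (x * y); rewrite in_setD1 Xxy andbT negb_and !negbK.
  by case/orP=> // /eqP->; apply: group1.
have := closed_connect closedA (connX 1 b).
by rewrite /= group1 (negbTE A'b).
Qed.

Lemma reflection_parity (i : nat) : (a ^+ i * b \in Y) = (a ^+ odd i * b \in Y).
Proof.
rewrite -{1}(odd_double_half i); elim: i./2 => [|j IHj]; first by rewrite addn0.
by rewrite doubleS !addnS -(dihedral_conj_refl D2n) connection_setJ.
Qed.

Lemma reflection_class :
  exists c : bool, forall i : nat, (a ^+ i * b \in Y) = (odd i == c).
Proof.
case Y0: (b \in Y); case Y1: (a * b \in Y).
- have allY x : x \in A -> x * b \in Y.
    case/cycleP=> i ->; rewrite reflection_parity.
    by case: odd; rewrite ?expg1 ?mul1g ?Y0 ?Y1.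
  have [h Hh nt_h] := trivgPn _ ntH; case/negP: nt_h.
  (* With all reflections in [Y], H contains none of them. A rotation h puts both b and b h = h^-1
     b, from the same coset of H, into [Y]. *)
  have [Ah | [i def_h]] := dihedral_cases D2n h; last first.
    case/negP: (subgroup_code_notin codeH Hh).
    by rewrite def_h allY ?mem_cycle.
  have H'b : b \notin H by apply: contraL Y0 => /(subgroup_code_notin codeH).
  have [c Hc mem_c] := subgroup_code_coset codeH H'b.
  have /eqP-> : h == c.
    by rewrite -mem_c // (dihedral_refl_swap D2n Ah) allY ?groupV.
  by rewrite eq_sym -mem_c ?group1 // mulg1.
- exists false => i; rewrite reflection_parity.
  by case: odd; rewrite ?expg1 ?mul1g ?Y0 ?Y1.
- exists true => i; rewrite reflection_parity.
  by case: odd; rewrite ?expg1 ?mul1g ?Y0 ?Y1.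
have [i] := connected_has_reflection.
by rewrite reflection_parity; case: odd; rewrite ?expg1 ?mul1g ?Y0 ?Y1.
Qed.

(** The reflections a^n b and a^0 b coincide, so n and 0 have the same parity. *)
Lemma dihedral_code_even : ~~ odd n.
Proof.
have [c memY] := reflection_class; have [_ _ an _ _] := D2n.
by have := memY 0; rewrite -[a ^+ 0]an memY; case: odd; case: (c).
Qed.

(** * The code and the rotations in the connection set, for a fixed reflection parity [c] *)

Section Parity.

Variable c : bool.
Hypothesis memY : forall i : nat, (a ^+ i * b \in Y) = (odd i == c).

Let n_even := dihedral_code_even.

Lemma reflection_mem (x : gT) : x \in A -> (x * b \in Y) = ((x \in E) != c).
Proof.
case/cycleP=> i ->; rewrite memY (dihedral_even_cycle n_gt0 D2n) //.
by case: odd; case: (c).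
Qed.

Lemma connection_set_split : Y = (a ^+ c * b) ^: [set: gT] :|: (Y :&: A).
Proof.
apply/setP=> g; rewrite in_setU in_setI (dihedral_class D2n) mem_rcoset.
have Ac : a ^+ c \in A by apply: mem_cycle.
have sEA : {subset E <= A} by apply/subsetP; rewrite cycle_subG mem_cycle.
have [Ag | [i ->]] := dihedral_cases D2n g.
  rewrite Ag andbT; case Eg: (g * _ \in E) => //.
  have := dihedral_refl_notin Ac.
  by rewrite -groupV -(groupMl _ Ag) (sEA _ Eg).
have Ai : a ^+ i \in A by apply: mem_cycle.
rewrite (negbTE (dihedral_refl_notin Ai)) andbF orbF invMg !mulgA mulgK memY.
rewrite (dihedral_even_cycleM n_gt0 D2n) ?groupV //.
by rewrite !(dihedral_even_cycle n_gt0 D2n) //; case: odd; case: (c).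
Qed.

(** Multiplying a^c b on the right by h gives a^c h^-1 b, of the same parity, hence a second element
    of [Y] in one coset of H unless h = 1. *)
Lemma code_even_rotation (h : gT) : h \in H -> h \in E -> h = 1.
Proof.
move=> Hh Eh; have Ah : h \in A.
  by apply: subsetP Eh; rewrite cycle_subG mem_cycle.
have Ac : a ^+ c \in A by apply: mem_cycle.
have Yv : a ^+ c * b \in Y by rewrite memY; case: (c).
have H'v : a ^+ c * b \notin H.
  by apply: contraL Yv => /(subgroup_code_notin codeH).
have [d Hd mem_d] := subgroup_code_coset codeH H'v.
have /eqP-> : h == d.
  rewrite -mem_d // -mulgA (dihedral_refl_swap D2n Ah) mulgA.
  have ?: a ^+ c * h^-1 \in A by rewrite groupM ?groupV.
  rewrite reflection_mem // (dihedral_even_cycleM n_gt0 D2n) ?groupV //.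
  by rewrite Eh eqb_id -reflection_mem.
by apply/eqP; rewrite eq_sym -mem_d ?group1 // mulg1.
Qed.

(* H is {1, r}, so exactly one of y and y r is in X for each rotation y <> 1,
   and y r is in X iff y is an odd power of a. *)
Lemma code_with_reflection (l : nat) (x : gT) : n = (2 * l)%N ->
  x \in A -> x * b \in H -> Y :&: A = even_powers a l.
Proof.
move=> def_n Ax Hr; set r := x * b in Hr.
have r2 : r * r = 1.
  rewrite /r -mulgA (mulgA b) (dihedral_refl_swap D2n Ax) -(mulgA x^-1).
  by rewrite (dihedral_mulbb D2n) mulg1 mulgV.
have nt_r : 1 != r.
  by apply: contraNneq (dihedral_refl_notin Ax) => r1; rewrite -/r -r1.
(* Being in H, r is outside [Y], so its parity is opposite to [c]. *)
have Ex : (x \in E) = c.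
  have := subgroup_code_notin codeH Hr.
  by rewrite reflection_mem // negbK => /eqP.
(* The reflection h r is in H too, so it has the parity of r and h is an even rotation. *)
have HA1 h : h \in H -> h \in A -> h = 1.
  move=> Hh Ah; apply: code_even_rotation => //.
  have := subgroup_code_notin codeH (groupM Hh Hr).
  rewrite mulgA reflection_mem ?(groupM Ah Ax) //
    (dihedral_even_cycleM n_gt0 D2n) // Ex.
  by case: (h \in E); case: (c).
(* Two reflections of H multiply to a rotation of H, which [HA1] makes trivial. *)
have H1r h : h \in H -> h = 1 \/ h = r.
  move=> Hh.
  have [/(HA1 h Hh) | [i def_h]] := dihedral_cases D2n h; first by left.
  right; apply: (mulIg r); rewrite r2; apply: HA1; first exact: groupM.
  rewrite def_h /r -mulgA (mulgA b) (dihedral_refl_swap D2n Ax) -(mulgA x^-1).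
  by rewrite (dihedral_mulbb D2n) mulg1 groupM ?mem_cycle ?groupV.
apply/setP=> y; rewrite (mem_even_powers n_gt0 D2n _ def_n) inE.
have [-> | nt_y] := eqVneq y 1; first by rewrite !inE eqxx.
case Ay: (y \in A); last first.
  rewrite andbF; apply/esym/negbTE; apply: contraFN Ay.
  by apply: subsetP; rewrite cycle_subG mem_cycle.
rewrite andbT /=.
have H'y : y \notin H by apply: contraNN nt_y => Hy; rewrite (HA1 y).
have [d Hd mem_d] := subgroup_code_coset codeH H'y.
rewrite -[y in y \in Y]mulg1 mem_d ?group1 //.
have := mem_d r Hr; rewrite mulgA reflection_mem ?(groupM Ay Ax) //.
rewrite (dihedral_even_cycleM n_gt0 D2n) // Ex.
have -> : ((y \in E) == c) != c = (y \notin E) by case: (y \in E); case: (c).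
have [-> | ->] := H1r d Hd.
  by rewrite eqxx eq_sym (negbTE nt_r) => /negbFE.
by rewrite eqxx (negbTE nt_r) => /negbTE.
Qed.

(** A nontrivial a^m in H has m odd, while its square is an even rotation in H, hence 1. So l
    divides m with odd quotient, which makes l odd and a^m = a^l. *)
Lemma rotation_code_generator (l : nat) : n = (2 * l)%N -> H \subset A ->
  odd l /\ H :=: <[a ^+ l]>.
Proof.
move=> def_n sHA; have [oa _] := dihedral_order n_gt0 D2n.
have nt_eq h : h \in H -> h != 1 -> odd l /\ h = a ^+ l.
  move=> Hh nt_h; have [m def_h] := cycleP _ _ (subsetP sHA h Hh).
  have E'h : h \notin E by apply: contraNN nt_h => /(code_even_rotation Hh)->.
  have m_odd : odd m.
    by move: E'h; rewrite def_h (dihedral_even_cycle n_gt0 D2n) // negbK.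
  have /eqP : h ^+ 2 = 1.
    apply: code_even_rotation; first exact: groupX.
    by rewrite def_h -expgM mulnC expgM mem_cycle.
  rewrite def_h -expgM -order_dvdn oa def_n [(m * 2)%N]mulnC dvdn_pmul2l //.
  case/dvdnP=> q def_m.
  move: m_odd; rewrite def_m oddM => /andP[q_odd l_odd]; split=> //.
  have al2 : (a ^+ l) ^+ 2 = 1 by rewrite -expgM mulnC -def_n -oa expg_order.
  rewrite mulnC expgM -(odd_double_half q) q_odd expgD -mul2n.
  by rewrite [X in _ * X]expgM al2 expg1n mulg1 expg1.
have [h Hh nt_h] := trivgPn _ ntH.
have [l_odd def_h] := nt_eq h Hh nt_h.
split=> //; apply/eqP; rewrite eqEsubset cycle_subG -def_h Hh andbT.
apply/subsetP=> g Hg; have [-> | nt_g] := eqVneq g 1; first exact: group1.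
by have [_ ->] := nt_eq g Hg nt_g; rewrite def_h cycle_id.
Qed.

(** The element 1 represents H, and the single element of [Y] in any other coset inside [A]
    represents that coset. Conjugation by [b] preserves [Y] and inverts rotations. *)
Lemma rotation_code_transversal : H \subset A ->
  [/\ left_transversal (1 |: (Y :&: A)) H A,
      inverse_closed (1 |: (Y :&: A))
    & (1 |: (Y :&: A)) :\: H = Y :&: A].
Proof.
move=> sHA; have Y'H h : h \in H -> (h \in Y) = false.
  by move/(subgroup_code_notin codeH)/negbTE.
split.
- apply/and3P; split.
  + exact: lcosets_partition.
  + by rewrite subUset sub1G subsetIr.
  apply/forall_inP=> _ /lcosetsP[x Ax ->].
  have [Hx | H'x] := boolP (x \in H).
    apply/cards1P; exists 1; apply/setP=> g.
    rewrite lcoset_id // in_setI in_setU1 in_setI in_set1.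
    have [-> | _] := eqVneq g 1; first by rewrite (group1 H).
    by case Hg: (g \in H); rewrite ?andbF // Y'H.
  have [d Hd mem_d] := subgroup_code_coset codeH H'x.
  apply/cards1P; exists (x * d); apply/setP=> g.
  rewrite -[g](mulKVg x); set h := x^-1 * g.
  rewrite in_setI mem_lcoset mulKg in_set1 (inj_eq (mulgI x)).
  case Hh: (h \in H); last first.
    by rewrite andbF; apply/esym; apply: contraFF Hh => /eqP->.
  rewrite andbT in_setU1 in_setI mem_d // (groupMl _ Ax) (subsetP sHA) // andbT.
  by rewrite orb_idl // => /eqP xh1; rewrite -(groupMr _ Hh) xh1 group1 in H'x.
- apply/setP=> g; rewrite inE !in_setU1 invg_eq1 !in_setI groupV.
  case Ag: (g \in A); last by rewrite !andbF.
  by rewrite -(dihedral_invJ D2n Ag) connection_setJ.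
apply/setP=> g; rewrite in_setD in_setU1 in_setI.
case Hg: (g \in H) => /=; first by rewrite Y'H.
by have [g1 | //] := eqVneq g 1; rewrite g1 group1 in Hg.
Qed.

End Parity.

End SubgroupPerfectCode.

(** * Assembly of the three cases *)

Unset Implicit Arguments.
Set Strict Implicit.

Theorem theorem5p9 (n : nat) (n_gt0 : (0 < n)%N)
    (gT : finGroupType) (a b : gT) (D2n : is_dihedral n a b)
    (X : {set gT}) (nX : X <| [set: gT])
    (connX : graph_connected (cayley_sum X))
    (H : {group gT}) (ntH : H :!=: 1)
    (codeH : perfect_code (cayley_sum X) H) :
  (exists l : nat, n = (2 * l)%N
     /\ X :\ 1 = (b ^: [set: gT]) :|: even_powers a l)
  \/ (exists l : nat, n = (2 * l)%N
     /\ X :\ 1 = ((a * b) ^: [set: gT]) :|: even_powers a l)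
  \/ (exists k : nat, [/\ (0 < k)%N, n = (4 * k + 2)%N
     & exists Z : {set gT},
         [/\ left_transversal Z <[a ^+ (2 * k + 1)]> <[a]>,
             inverse_closed Z
           & X :\ 1 = (b ^: [set: gT]) :|: (Z :\: <[a ^+ (2 * k + 1)]>)
             \/ X :\ 1 = ((a * b) ^: [set: gT])
                           :|: (Z :\: <[a ^+ (2 * k + 1)]>)]]).
Proof.
have [c memY] := reflection_class n_gt0 D2n nX connX ntH codeH.
have n_even := dihedral_code_even n_gt0 D2n nX connX ntH codeH.
have def_n : n = (2 * n./2)%N by rewrite mul2n even_halfK.
have defY := connection_set_split n_gt0 D2n nX connX ntH codeH memY.
have finish_even : (X :\ 1) :&: <[a]> = even_powers a n./2 ->
  (exists l : nat, n = (2 * l)%N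
     /\ X :\ 1 = (b ^: [set: gT]) :|: even_powers a l)
  \/ (exists l : nat, n = (2 * l)%N
     /\ X :\ 1 = ((a * b) ^: [set: gT]) :|: even_powers a l).
  (* An odd parity selects the class of [a * b], an even one that of [b]. *)
  move=> defYA; rewrite defYA in defY.
  case: c {memY} defY => defY; [right | left]; exists n./2.
    by rewrite -[a in a * b]expg1.
  by rewrite -{1}[b]mul1g.
have [sHA | /subsetPn[r Hr A'r]] := boolP (H \subset <[a]>); last first.
  have [Ar | [i def_r]] := dihedral_cases D2n r; first by rewrite Ar in A'r.
  rewrite def_r in Hr.
  have [||] := finish_even; [|by left|by right; left].
  exact: (code_with_reflection n_gt0 D2n nX connX ntH codeH memY def_n
            (mem_cycle a i) Hr).
have [l_odd defH] :=
  rotation_code_generator n_gt0 D2n nX connX ntH codeH memY def_n sHA.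
have [trZ invZ defZ] := rotation_code_transversal D2n nX codeH sHA.
(* For n = 2 case (c) would need k = 0. Here H is all of [<[a]>], so the connection set has no
   nontrivial rotation and the empty list of even powers fits. *)
have [l1 | l_neq1] := eqVneq n./2 1%N.
  have [||] := finish_even; [|by left|by right; left].
  have [_ _ an _ _] := D2n.
  apply/setP=> g; rewrite (mem_even_powers n_gt0 D2n _ def_n).
  rewrite l1 muln1 in def_n; rewrite -def_n an cycle1 in_set1 andNb.
  apply/negbTE/negP=> /setIP[Yg Ag].
  have Hg : g \in H by rewrite defH l1 expg1.
  by case/negP: (subgroup_code_notin codeH Hg).
right; right; exists (n./2)./2.
have def_l : n./2 = (2 * (n./2)./2 + 1)%N.
  by rewrite -{1}(odd_double_half n./2) l_odd mul2n addnC.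
rewrite -def_l -defH; split.
- by rewrite lt0n; apply: contraNneq l_neq1 => k0; rewrite def_l k0.
- by rewrite {1}def_n {1}def_l mulnDr mulnA.
(* The rotations of the connection set represent the nontrivial cosets; adjoining 1 covers H. *)
exists (1 |: (X :\ 1) :&: <[a]>); rewrite defZ; split=> //.
case: c {memY finish_even} defY => defY; [right | left].
  by rewrite -[a in a * b]expg1.
by rewrite -{1}[b]mul1g.
Qed.
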